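(* For every (possibly infinite) graph $G$, $\operatorname{odw}(G)-1\le \operatorname{glc}(G)\le 3\operatorname{odw}(G)$.
   Context: Graphs may be infinite. A tree-decomposition of $G$ is a pair $(T,(B_t:t\in V(T)))$ where $T$ is a (possibly infinite) tree and $B_t\subseteq V(G)$, such that $V(G)=\bigcup_t B_t$; every edge of $G$ has both ends in some $B_t$; and if $t_2$ lies on the $T$-path between $t_1,t_3$ then $B_{t_1}\cap B_{t_3}\subseteq B_{t_2}$. $d_G(u,v)$ is the length (number of edges) of a shortest $u$–$v$ path ($\infty$ if none). The outer diameter of a tree-decomposition is $\sup_t\max_{u,v\in B_t}d_G(u,v)$, and $\operatorname{odw}(G)$ is its minimum over all tree-decompositions of $G$. A loaded cycle is a pair $(C,F)$ where $C$ is a cycle of $G$ and $F\subseteq E(C)$; its load is $|F|$. For distinct $u,v\in V(C)$, $d_{C,F}(u,v)$ is the smaller of $|E(P)\cap F|,|E(Q)\cap F|$ where $P,Q$ are the two paths of $C$ between $u,v$; $d_{C,F}(u,u)=0$. $(C,F)$ is geodesic if $d_G(u,v)\ge d_{C,F}(u,v)$ for all $u,v\in V(C)$. $\operatorname{glc}(G)$ is the maximum load of a geodesic loaded cycle of $G$, $\infty$ if there is no maximum, and $0$ if $G$ has no cycle. *)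

(* Defs.v *)
From mathcomp Require Import all_boot all_order all_algebra.
From mathcomp Require Import all_classical all_reals ereal.

Set Implicit Arguments.
Unset Strict Implicit.
Unset Printing Implicit Defensive.

Import Order.TTheory GRing.Theory Num.Theory.

Local Open Scope classical_set_scope.
Local Open Scope ring_scope.

(* Simple graphs, with an arbitrary (possibly infinite, possibly empty) set of
   vertices. *)
Record graph := Graph {
  vertex :> Type;
  adj : vertex -> vertex -> Prop;
  adj_sym : forall u v, adj u v -> adj v u;
  adj_irr : forall v, ~ adj v v
}.

(* The path p 0, p 1, ..., p n, with n edges and pairwise distinct vertices;
   the values of p beyond n are irrelevant. *)
Definition is_path (G : graph) (n : nat) (p : nat -> G) : Prop :=
  (forall i j, (i <= n)%N -> (j <= n)%N -> p i = p j -> i = j) /\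
  (forall i, (i < n)%N -> adj (p i) (p i.+1)).

(* The cycle c 0, ..., c (n-1), c 0.  Its n edges are indexed by 'I_n: the edge
   of index k joins c k to c (k+1 mod n).  Since n >= 3, distinct indices give
   distinct edges. *)
Definition is_cycle (G : graph) (n : nat) (c : 'I_n -> G) : Prop :=
  [/\ (3 <= n)%N, injective c & forall k, adj (c k) (c (ordS k))].

Definition connected_graph (G : graph) : Prop :=
  forall u v : G, exists n p, [/\ @is_path G n p, p 0%N = u & p n = v].

Definition is_tree (T : graph) : Prop :=
  [/\ inhabited T, connected_graph T & forall n c, ~ @is_cycle T n c].

Record tree_decomposition (G T : graph) (B : T -> set G) : Prop := {
  td_tree : is_tree T;
  td_vertex : forall v : G, exists t, B t v;
  td_edge : forall u v : G, adj u v -> exists t, B t u /\ B t v;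
  td_path : forall n p, @is_path T n p -> forall i, (i <= n)%N ->
    B (p 0%N) `&` B (p n) `<=` B (p i)
}.

(* A set F of edges of the cycle c is given by the set of their indices.  The
   two paths of c between c i and c j have edge sets [cycle_arc i j] and its
   complement.  When i = j the arc is empty, so that [load_dist F i i] is 0. *)
Definition cycle_arc n (i j : 'I_n) : {set 'I_n} :=
  [set k : 'I_n | (minn i j <= k < maxn i j)%N]%SET.

Definition load_dist n (F : {set 'I_n}) (i j : 'I_n) : nat :=
  minn #|cycle_arc i j :&: F|%SET #|~: cycle_arc i j :&: F|%SET.

(* The parameters below take values in {0, 1, 2, ...} together with +oo; these
   are regarded as elements of the complete lattice \bar R.  An infimum of such
   values is a minimum, and their supremum is a maximum unless it is +oo. *)
Local Open Scope ereal_scope.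

Definition dist (R : realType) (G : graph) (u v : G) : \bar R :=
  ereal_inf [set x | exists n p,
    [/\ @is_path G n p, p 0%N = u, p n = v & x = n%:R%:E]].

(* In \bar R the supremum of the empty set is -oo; adjoining 0, here and in
   [glc], makes it 0 and leaves the suprema of nonempty sets unchanged, as
   their elements are nonnegative. *)
Definition bag_diameter (R : realType) (G : graph) (A : set G) : \bar R :=
  ereal_sup (0 |` [set x | exists u v, [/\ A u, A v & x = dist R u v]]).

Definition outer_diameter (R : realType) (G T : graph) (B : T -> set G) : \bar R :=
  ereal_sup [set bag_diameter R (B t) | t in [set: T]].

Definition odw (R : realType) (G : graph) : \bar R :=
  ereal_inf [set x | exists (T : graph) (B : T -> set G),
    tree_decomposition B /\ x = outer_diameter R B].

Definition geodesic (R : realType) (G : graph) n (c : 'I_n -> G) (F : {set 'I_n}) : Prop :=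
  forall i j, (load_dist F i j)%:R%:E <= dist R (c i) (c j).

Definition glc (R : realType) (G : graph) : \bar R :=
  ereal_sup (0 |` [set x | exists n (c : 'I_n -> G) (F : {set 'I_n}),
    [/\ is_cycle c, geodesic R c F & x = #|F|%:R%:E]]).

(* Main.v *)
(* Upper bound.  In a tree-decomposition, if the ends of a path with at least
   two edges lie in a common bag, then some bag contains both ends and an
   interior vertex.  Were every distance within a bag less than a third of the
   load of a geodesic loaded cycle, one could start from the path obtained by
   deleting an edge of the cycle and split it repeatedly, always keeping a
   subpath with ends in a common bag that carries at least a third of the load;
   it would end as a single edge carrying too much.

   Lower bound.  Choose a root in each component and let the level of a vertex
   be its distance to the root.  The bag of a component D of the subgraph of the
   vertices of level at least i consists of the vertices of D of level i and
   their neighbours of level i - 1.  Two vertices u, v of a bag at distance m are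
   joined by a path whose interior lies at levels at least those of u and v;
   closing it with shortest paths towards the root gives a cycle, and loading
   the top m or m - 1 edges of these shortest paths makes it geodesic. *)

Require Import Defs.
From mathcomp Require Import all_boot all_order all_algebra.
From mathcomp Require Import all_classical all_reals ereal.
From mathcomp Require Import zify.

Set Implicit Arguments.
Unset Strict Implicit.
Unset Printing Implicit Defensive.

Import Order.TTheory GRing.Theory Num.Theory.

Local Open Scope classical_set_scope.
Local Open Scope nat_scope.

(** * Walks inside a set of vertices *)

(** Walks rather than paths, so that they concatenate freely; [linked_path] recovers distinct
    vertices where these are needed. *)
Definition linked (G : graph) (A : set G) (n : nat) (u v : G) : Prop :=
  exists p : nat -> G, [/\ p 0 = u, p n = v, forall i, i <= n -> A (p i) &
    forall i, i < n -> adj (p i) (p i.+1)].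

Lemma linked_refl (G : graph) (A : set G) u : A u -> linked A 0 u u.
Proof. by move=> Au; exists (fun=> u). Qed.

Lemma linked_edge (G : graph) (A : set G) u v :
  A u -> A v -> adj u v -> linked A 1 u v.
Proof.
move=> Au Av uv; exists (fun i => if i is 0 then u else v); split => //.
- by case=> [|[|i]].
- by case=> [|i].
Qed.

Lemma linked_trans (G : graph) (A : set G) m n u v w :
  linked A m u v -> linked A n v w -> linked A (m + n) u w.
Proof.
move=> [p [p0 pm pA padj]] [q [q0 qn qA qadj]].
exists (fun i => if i <= m then p i else q (i - m)); split => //.
- case: leqP => [le|_]; last by rewrite addKn.
  have n0 : n = 0 by lia.
  by rewrite n0 addn0 pm -q0 -qn n0.
- by move=> i ile; case: leqP => [/pA//|lt]; apply: qA; lia.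
- move=> i ilt; case: (ssrnat.ltngtP i m) => [lt|gt|im]; last subst i.
  + by apply: padj.
  + have -> : i.+1 - m = (i - m).+1 by lia.
    by apply: qadj; lia.
  + rewrite subSnn.
    by rewrite pm -q0; apply: qadj; lia.
Qed.

Lemma linked_sym (G : graph) (A : set G) n u v :
  linked A n u v -> linked A n v u.
Proof.
move=> [p [p0 pn pA padj]]; exists (fun i => p (n - i)); split.
- by rewrite subn0.
- by rewrite subnn.
- by move=> i ile; apply: pA; lia.
- move=> i ilt; apply: adj_sym.
  have -> : n - i = (n - i.+1).+1 by lia.
  by apply: padj; lia.
Qed.

Lemma linked_sub (G : graph) (A B : set G) n u v :
  A `<=` B -> linked A n u v -> linked B n u v.
Proof.
by move=> AB [p [p0 pn pA padj]]; exists p; split => // i /pA /AB.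
Qed.

(** Cutting out the closed part between two visits to a repeated vertex shortens the walk and keeps
    it inside [A]. *)
Lemma linked_path (G : graph) (A : set G) n u v : linked A n u v ->
  exists m p, [/\ m <= n, is_path m p, p 0 = u, p m = v &
    forall i, i <= m -> A (p i)].
Proof.
elim/ltn_ind: n => n IH [p [p0 pn pA padj]].
case: (pselect (exists i j, [/\ i < j, j <= n & p i = p j])); last first.
  move=> inj; exists n, p; split => //; split => // i j ile jle pij.
  by case: (ssrnat.ltngtP i j) => // ?; case: inj; [exists i, j|exists j, i].
move=> [i [j [ij jn pij]]].
have [] := IH (n - (j - i)); first by lia.
- exists (fun k => if k <= i then p k else p (k + (j - i))); split => //.
  + case: leqP => [le|lt]; last by rewrite -pn; congr p; lia.
    have <- : i = n - (j - i) by lia.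
    by rewrite pij -pn; congr p; lia.
  + by move=> k kle; case: leqP => ?; apply: pA; lia.
  + move=> k kle; case: (ssrnat.ltngtP k i) => [lt|gt|eq].
    * by apply: padj; lia.
    * have -> : k.+1 + (j - i) = (k + (j - i)).+1 by lia.
      by apply: padj; lia.
    * rewrite eq pij.
      have -> : i.+1 + (j - i) = j.+1 by lia.
      by apply: padj; lia.
- move=> m [q [mle qpath q0 qm qA]]; exists m, q; split => //; lia.
Qed.

Lemma path_linked (G : graph) n (p : nat -> G) i j :
  is_path n p -> i <= j -> j <= n -> linked setT (j - i) (p i) (p j).
Proof.
move=> [_ padj] ij jn; exists (fun k => p (k + i)); split => //.
- by rewrite subnK.
- by move=> k klt /=; apply: padj; lia.
Qed.

Lemma dist_le (R : realType) (G : graph) n (u v : G) :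
  linked setT n u v -> (dist R u v <= n%:R%:E)%E.
Proof.
move=> /linked_path[m [p [mn pp p0 pm _]]]; apply: ge_ereal_inf.
exists (m%:R%:E); first by exists m, p.
by rewrite lee_fin ler_nat.
Qed.

Lemma le_dist (R : realType) (G : graph) m (u v : G) :
  (forall n, linked setT n u v -> m <= n) -> (m%:R%:E <= dist R u v)%E.
Proof.
move=> H; apply/ereal_infP => x [n [p [pp p0 pn ->]]].
rewrite lee_fin ler_nat; apply: H; rewrite -p0 -pn -[n in linked _ n]subn0.
exact: path_linked pp _ _.
Qed.

Lemma geodesic_le (R : realType) (G : graph) n (c : 'I_n -> G) (F : {set 'I_n})
    i j l :
  geodesic R c F -> linked setT l (c i) (c j) -> load_dist F i j <= l.
Proof.
move=> geo /(dist_le R) h; have := le_trans (geo i j) h.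
by rewrite lee_fin ler_nat.
Qed.

(** * Tree-decompositions and geodesic loaded cycles *)

Lemma bags_linked (G T : graph) (B : T -> set G) (v : G) (s t : T) :
  tree_decomposition B -> B s v -> B t v ->
  exists n, linked [set x | B x v] n s t.
Proof.
move=> td Bs Bt; have [_ conn _] := td_tree td.
have [n [q [qp q0 qn]]] := conn s t.
exists n, q; split => //; last by case: qp.
by move=> i ile /=; apply: (td_path td qp ile); rewrite q0 qn.
Qed.

(** The nodes whose bag contains a given vertex are connected in the tree, and the sets of nodes of
    consecutive vertices of [p] meet because every edge lies in a bag. *)
Lemma path_bags_linked (G T : graph) (B : T -> set G) (p : nat -> G) a b s t :
  tree_decomposition B -> a <= b ->
  (forall i, a <= i < b -> adj (p i) (p i.+1)) -> B s (p a) -> B t (p b) ->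
  exists n, linked [set x | exists2 i, a <= i <= b & B x (p i)] n s t.
Proof.
move=> td; elim: b t => [|b IH] t ab padj Bs Bt.
  have a0 : a = 0 by lia.
  rewrite a0 in Bs; have [n nst] := bags_linked td Bs Bt.
  by exists n; apply: linked_sub nst => x Bx; exists 0 => //; lia.
case: (ltnP b a) => [ba|ab'].
  have ab1 : a = b.+1 by lia.
  rewrite ab1 in Bs; have [n nst] := bags_linked td Bs Bt.
  by exists n; apply: linked_sub nst => x Bx; exists b.+1 => //; lia.
have [r [Br Br']] : exists t, B t (p b) /\ B t (p b.+1).
  by apply: (td_edge td); apply: padj; lia.
have [|m sr] := IH r ab' _ Bs Br; first by move=> i ?; apply: padj; lia.
have [n rt] := bags_linked td Br' Bt.
exists (m + n); apply: (@linked_trans _ _ _ _ _ r).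
  by apply: linked_sub sr => x [i ? ?]; exists i => //; lia.
by apply: linked_sub rt => x Bx; exists b.+1 => //; lia.
Qed.

(* Take a shortest path of the tree from a node whose bag contains both ends to
   a node whose bag meets the interior.  If it had an edge, its second node
   would still lie between two nodes whose bags contain [p a] (reaching the
   second one through bags that meet the interior), and likewise for [p b]. *)
Lemma common_bag (G T : graph) (B : T -> set G) (p : nat -> G) a b t :
  tree_decomposition B -> a.+1 < b ->
  (forall i, a <= i < b -> adj (p i) (p i.+1)) -> B t (p a) -> B t (p b) ->
  exists w r, [/\ a < w < b, B r (p a), B r (p w) & B r (p b)].
Proof.
move=> td ab padj Ba Bb.
pose X := [set x | exists2 i, a < i < b & B x (p i)].
have Xlinked x y : X x -> X y -> exists n, linked X n x y.
  move=> [i ilt Bx] [j jlt By].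
  wlog ij : x y i j ilt jlt Bx By / i <= j.
    move=> H; case: (leqP i j) => [/H|/ltnW /H]; first exact.
    move=> /(_ y x)[]// n yx.
    by exists n; apply: linked_sym.
  have [|n nxy] := path_bags_linked td ij _ Bx By.
    by move=> k ?; apply: padj; lia.
  by exists n; apply: linked_sub nxy => z [k ? ?]; exists k => //; lia.
have [s1 [Bs1 Bs1']] : exists s, B s (p a) /\ B s (p a.+1).
  by apply: (td_edge td); apply: padj; lia.
have [s2 [Bs2 Bs2']] : exists s, B s (p b.-1) /\ B s (p b).
  have := td_edge td (padj b.-1 _); rewrite prednK; last by lia.
  by apply; lia.
have Xs1 : X s1 by exists a.+1 => //; lia.
have Xs2 : X s2 by exists b.-1 => //; lia.
have [n] : exists n, exists t s, [/\ B t (p a), B t (p b), X s & linked setT n t s].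
  have [_ conn _] := td_tree td; have [n [q [qp q0 qn]]] := conn t s1.
  exists n, t, s1; split => //; rewrite -q0 -qn -[n in linked _ n]subn0.
  exact: path_linked qp _ _.
elim/ltn_ind: n {t Ba Bb} => n IH [t [s [Ba Bb Xs ts]]].
have [m [q [mn qp q0 qm _]]] := linked_path ts.
case: m => [|m] in mn qp qm *.
  have ets : t = s by rewrite -q0 -qm.
  by case: Xs => i ilt Bi; exists i, t; split => //; rewrite ets.
case: (pselect (exists2 i, i <= m & X (q i))) => [[i im Xi]|noX].
  apply: (IH i); first by lia.
  exists t, (q i); split => //; rewrite -q0 -[i in linked _ i]subn0.
  by apply: path_linked qp _ _; lia.
(* Before its end [s] the path [q] avoids [X], while [r] stays in [X]; so their concatenation [z] is
   a path of the tree from [t] to [s'] through [q 1]. *)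
have in_q1 v s' : B t v -> X s' -> B s' v -> B (q 1) v.
  move=> Btv Xs' Bs'v; have [l ss'] := Xlinked _ _ Xs Xs'.
  have [k [r [_ [rinj radj] r0 rk rX]]] := linked_path ss'.
  pose z i := if i <= m.+1 then q i else r (i - m.+1).
  have zr i : m < i -> z i = r (i - m.+1).
    move=> mi; rewrite /z; case: (leqP i m.+1) => // im; have -> : i = m.+1 by lia.
    by rewrite subnn qm r0.
  have zq i : i <= m.+1 -> z i = q i by rewrite /z => ->.
  have zp : is_path (m.+1 + k) z.
    case: qp => qinj qadj; split => [i j ile jle|i ilt]; last first.
      case: (ltnP i m.+1) => [im|mi].
        by rewrite !zq //; [apply: qadj|lia].
      rewrite !zr //; [|lia].
      by rewrite subSn //; apply: radj; lia.
    wlog ij : i j ile jle / i <= j.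
      by move=> H; case: (leqP i j) => [/H|/ltnW /H h e]; [apply|apply/esym/h].
    case: (leqP j m) => [jm|mj].
      by rewrite !zq //; [move/qinj; apply; lia|lia|lia].
    case: (leqP i m) => [im|mi].
      rewrite (zr j) // (zq i); last by lia.
      move=> e; case: noX; exists i => //; rewrite e; apply: rX; lia.
    rewrite !zr // => /rinj e.
    have : i - m.+1 = j - m.+1 by apply: e; lia.
    by lia.
  have := td_path td zp (isT : 1 <= m.+1 + k).
  rewrite (zq 1) //; apply; split; first by rewrite zq // q0.
  by rewrite zr ?addKn ?rk //; lia.
have Bq1a := in_q1 _ _ Ba Xs1 Bs1; have Bq1b := in_q1 _ _ Bb Xs2 Bs2'.
apply: (IH m); first by lia.
exists (q 1), s; split => //.
by have := path_linked qp (isT : 1 <= m.+1) (leqnn _); rewrite subn1 qm.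
Qed.

Lemma cycle_arc_sym n (i j : 'I_n) : cycle_arc i j = cycle_arc j i.
Proof. by rewrite /cycle_arc minnC maxnC. Qed.

Lemma load_dist_sym n (F : {set 'I_n}) (i j : 'I_n) :
  load_dist F i j = load_dist F j i.
Proof. by rewrite /load_dist cycle_arc_sym. Qed.

Lemma card_cycle_arc_split n (F : {set 'I_n}) (i w j : 'I_n) :
  i <= w -> w <= j ->
  #|cycle_arc i j :&: F|%SET = #|cycle_arc i w :&: F|%SET + #|cycle_arc w j :&: F|%SET.
Proof.
move=> iw wj; rewrite -(cardsID (cycle_arc i w) (cycle_arc i j :&: F)%SET).
by congr (_ + _); apply: eq_card => k; rewrite !inE; case: (k \in F); lia.
Qed.

Lemma card_cycle_arcC n (F : {set 'I_n}) (i j : 'I_n) :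
  #|cycle_arc i j :&: F|%SET + #|~: cycle_arc i j :&: F|%SET = #|F|.
Proof.
by rewrite -(cardsID (cycle_arc i j) F) finset.setIC finset.setDE [(F :&: ~: _)%SET]finset.setIC.
Qed.

(** The 1 in [maxn] costs nothing, distinct vertices being at distance at least 1. It lets one
    assume a load above 3, so that a single edge carries less than a third. *)
Lemma geodesic_load (G T : graph) (B : T -> set G) n (c : 'I_n -> G)
    (F : {set 'I_n}) :
  tree_decomposition B -> is_cycle c ->
  exists t i j, [/\ i != j, B t (c i), B t (c j) &
    #|F| <= 3 * maxn 1 (load_dist F i j)].
Proof.
move=> td [n3 cinj cadj]; apply: contrapT => none.
have {}none t i j : i != j -> B t (c i) -> B t (c j) ->
    3 < #|F| /\ 3 * load_dist F i j < #|F|.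
  move=> ij Bi Bj; suff : 3 * maxn 1 (load_dist F i j) < #|F| by lia.
  by rewrite ltnNge; apply/negP => le; apply: none; exists t, i, j.
case: n => [|n] in n3 c F cinj cadj none *; first by lia.
have last0 : ordS ord_max = ord0 :> 'I_n.+1 by apply: val_inj; rewrite /= modnn.
have [t [Bt Bt0]] := td_edge td (cadj ord_max); rewrite last0 in Bt0.
have m0 : ord0 != ord_max :> 'I_n.+1 by rewrite -val_eqE /=; lia.
have [F3 _] := none _ _ _ m0 Bt0 Bt.
(* An arc with ends in a common bag carries less than a third of the load. This is absurd for the
   arc from [ord0] to [ord_max], which misses only one edge. *)
suff big d (i j : 'I_n.+1) t' : j - i <= d -> i < j -> B t' (c i) -> B t' (c j) ->
    3 * #|cycle_arc i j :&: F|%SET < #|F|.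
  have := big n ord0 ord_max t; rewrite subn0 leqnn => /(_ isT).
  have -> : ord0 < @ord_max n by rewrite /=; lia.
  move=> /(_ isT Bt0 Bt).
  have := card_cycle_arcC F ord0 ord_max.
  have : #|~: cycle_arc ord0 ord_max :&: F|%SET <= 1.
    rewrite -(cards1 (@ord_max n)); apply: subset_leq_card; apply/fintype.subsetP => k.
    by rewrite !inE -val_eqE /= => /andP[+ _]; have := ltn_ord k; lia.
  by lia.
elim: d i j t' => [|d IH] i j t' dij ij Bi Bj; first by lia.
have ineqj : i != j by rewrite -val_eqE /=; lia.
have [_] := none _ _ _ ineqj Bi Bj; rewrite /load_dist.
have := card_cycle_arcC F i j; set x := #|_|; set y := #|_|; move=> xy.
(* One of [x] and [y] is below a third of their sum [#|F|]. If [x] is at most two thirds of it, then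
   [y] is at least a third, so the small one is [x]. *)
suff : 3 * x <= 2 * #|F| by lia.
have [ij1|ij2] := leqP j i.+1.
  have : x <= 1; last by lia.
  rewrite -(cards1 i); apply: subset_leq_card; apply/fintype.subsetP => k.
  by rewrite !inE -val_eqE /= => /andP[+ _]; lia.
have cE (k : 'I_n.+1) : c (inord k) = c k by rewrite inord_val.
have [|||w [r [/andP[iw wj] ri rw rj]]] :=
    @common_bag _ _ _ (fun k => c (inord k)) i j t' td ij2.
- move=> k /andP[ik kj]; have := cadj (inord k); congr adj; congr c.
  apply: val_inj; rewrite /= !inordK //; have := ltn_ord j; [|lia..].
  by move=> ?; rewrite modn_small; lia.
- by rewrite cE.
- by rewrite cE.
have wn : w < n.+1 by have := ltn_ord j; lia.
rewrite !cE in ri rj.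
have wE : @inord n w = w :> nat by rewrite inordK.
have h1 := IH i (inord w) r _ _ ri rw.
have h2 := IH (inord w) j r _ _ rw rj.
rewrite /x (@card_cycle_arc_split _ F i (inord w) j) ?wE; [|lia..].
by rewrite !wE in h1 h2; move: h1 h2; lia.
Qed.

Lemma glc_le_odw (R : realType) (G : graph) :
  (glc R G <= 3%:R%:E * odw R G)%E.
Proof.
have od_ge0 (T : graph) (B : T -> set G) : tree_decomposition B ->
    (0 <= outer_diameter R B)%E.
  move=> td; have [[t] _ _] := td_tree td; apply: le_ereal_sup_tmp.
  exists (bag_diameter R (B t)); first by exists t.
  by apply: le_ereal_sup_tmp; exists 0%E => //; left.
(* This bounds the element 0 adjoined in [glc]. *)
have odw_ge0 : (0 <= odw R G)%E.
  by apply/ereal_infP => _ [T [B [td ->]]]; apply: od_ge0.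
apply/ereal_supP => _ [->|[n [c [F [cyc geo ->]]]]].
  by rewrite mule_ge0 // lee_fin.
rewrite -lee_pdivrMl ?ltr0n //; apply/ereal_infP => _ [T [B [td ->]]].
rewrite lee_pdivrMl ?ltr0n //.
have [t [i [j [ij Bi Bj le]]]] := geodesic_load F td cyc.
apply: (@le_trans _ _ (3%:R%:E * (maxn 1 (load_dist F i j))%:R%:E)%E).
  by rewrite -EFinM lee_fin -natrM ler_nat.
apply: lee_wpmul2l; first by rewrite lee_fin.
apply: (@le_trans _ _ (dist R (c i) (c j))).
  apply: le_dist => l ld; rewrite geq_max (geodesic_le geo ld) andbT.
  case: l ld => // -[p [p0 p0' _ _]].
  have [_ cinj _] := cyc; case/eqP: ij; apply: cinj; by rewrite -p0 -p0'.
apply: le_ereal_sup_tmp; exists (bag_diameter R (B t)); first by exists t.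
apply: le_ereal_sup_tmp; exists (dist R (c i) (c j)) => //; right.
by exists (c i), (c j).
Qed.

(** * Rooted trees *)

(** In [ranked] the root is its own parent; [u <> v] discards that loop. *)
Definition parent_adj (V : Type) (par : V -> V) (u v : V) : Prop :=
  u <> v /\ (par u = v \/ par v = u).

Lemma parent_adj_sym V (par : V -> V) u v :
  parent_adj par u v -> parent_adj par v u.
Proof. by move=> [uv /or_comm par_uv]; split => // /esym. Qed.

Lemma parent_adj_irr V (par : V -> V) v : ~ parent_adj par v v.
Proof. by case. Qed.

Definition parent_graph (V : Type) (par : V -> V) : graph :=
  Graph (@parent_adj_sym V par) (@parent_adj_irr V par).

Definition ranked (V : Type) (par : V -> V) (root : V) (rank : V -> nat) : Prop :=
  par root = root /\ forall v, v <> root -> rank (par v) < rank v.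

Lemma parent_adjP V (par : V -> V) root rank u v :
  ranked par root rank -> parent_adj par u v ->
  (v = par u /\ rank v < rank u) \/ (u = par v /\ rank u < rank v).
Proof.
move=> [par_root lt_par] [uv [e|e]]; [left|right]; split => //; rewrite -e;
  by apply: lt_par => eroot; apply: uv; rewrite -e eroot par_root.
Qed.

(* On a cycle, both neighbours of a vertex of largest rank would be its parent. *)
Lemma parent_graph_tree V (par : V -> V) root rank :
  ranked par root rank -> is_tree (parent_graph par).
Proof.
move=> rk; have [par_root lt_par] := rk; split; first by split; exact: root.
- have to_root u : exists n, @linked (parent_graph par) setT n u root.
    have [r] := ubnP (rank u); elim: r u => // r IH u ur.
    case: (pselect (u = root)) => [->|uroot]; first by exists 0; apply: linked_refl.
    have lt := lt_par u uroot.
    have [n nu] := IH (par u) (leq_trans lt ur).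
    exists (1 + n); apply: linked_trans nu; apply: linked_edge => //.
    by split; [move=> e; rewrite -e ltnn in lt|left].
  move=> u v; have [m ru] := to_root u; have [n rv] := to_root v.
  have [k [p [_ pp p0 pk _]]] := linked_path (linked_trans ru (linked_sym rv)).
  by exists k, p.
- move=> n c [n3 cinj cadj].
  case: n => [|n] in n3 c cinj cadj *; first by lia.
  pose k := [arg max_(i > (ord0 : 'I_n.+1)) rank (c i)].
  have kmax i : rank (c i) <= rank (c k) by rewrite /k; case: arg_maxnP => // j _; apply.
  have up i : adj (c k) (c i) -> c i = par (c k).
    move=> /(parent_adjP rk)[[]//|[_]]; have := kmax i; lia.
  have e1 := up _ (cadj k).
  have e2 : c (ord_pred k) = par (c k).
    by apply: up; apply: adj_sym; have := cadj (ord_pred k); rewrite ord_predK.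
  have := cinj _ _ (etrans e1 (esym e2)) => /(congr1 (@ordS _)).
  rewrite ord_predK => /(congr1 val) /=.
  have := ltn_ord k; case: (ltnP k.+1 n.+1) => kn _.
    rewrite (modn_small kn); case: (ltnP k.+2 n.+1) => kn'.
      by rewrite (modn_small kn'); lia.
    have -> : k.+2 = n.+1 by lia.
    by rewrite modnn; lia.
  have -> : k.+1 = n.+1 by have := ltn_ord k; lia.
  by rewrite modnn modn_small; have := ltn_ord k; lia.
Qed.

(** After a descending step, a climb would lead to the unique parent, which is the previous vertex
    of the path. *)
Lemma parent_path_down V (par : V -> V) root rank n p i :
  ranked par root rank -> @is_path (parent_graph par) n p ->
  0 < n -> rank (p 0) < rank (p 1) -> i < n ->
  rank (p 0) < rank (p i.+1) /\ p i = par (p i.+1).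
Proof.
move=> rk [pinj padj] n0 p01; elim: i => [|i IH] lt.
  by split => //; have [[_]|[]//] := parent_adjP rk (padj 0 lt); lia.
have [ri ei] := IH (ltnW lt).
have [[e _]|[e lt']] := parent_adjP rk (padj i.+1 lt); last by split => //; lia.
have : i = i.+2 by apply: pinj; [lia|lia|rewrite ei e].
by lia.
Qed.

Lemma parent_rev_path V (par : V -> V) n p :
  @is_path (parent_graph par) n p ->
  @is_path (parent_graph par) n (fun i => p (n - i)).
Proof.
move=> [pinj padj]; split => [i j ile jle /pinj e|i ilt].
  by have := e ltac:(lia) ltac:(lia); lia.
apply: adj_sym; have -> : n - i = (n - i.+1).+1 by lia.
by apply: padj; lia.
Qed.

(* A path of a rooted tree climbs and then descends, so when its ends are in
   [S] either its first or its last step remains in [S]. *)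
Lemma parent_path_convex V (par : V -> V) root rank (S : set V) s n p i :
  ranked par root rank -> (forall t, S t -> t <> s -> S (par t)) ->
  (forall t, S t -> rank s <= rank t) ->
  @is_path (parent_graph par) n p -> S (p 0) -> S (p n) -> i <= n -> S (p i).
Proof.
move=> rk Spar smin; elim: n p i => [|n IH] p i pp S0 Sn ile.
  by have -> : i = 0 by lia.
have [pinj padj] := pp.
have IHl : S (p 1) -> S (p i).
  case: i ile => // i ile S1; apply: (IH (fun i => p i.+1)) => //.
  by split => [a b ? ? /pinj e|a ?]; [have := e ltac:(lia) ltac:(lia); lia|apply: padj].
have IHr : S (p n) -> S (p i).
  move=> Sn'; case: (leqP i n) => [ile'|lt]; last by have -> : i = n.+1 by lia.
  by apply: IH => //; split => [a b ? ?|a ?]; [apply: pinj|apply: padj]; lia.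
have [[e1 lt1]|[e1 lt1]] := parent_adjP rk (padj 0 isT).
  case: (pselect (p 0 = s)) => [p0s|p0s]; last first.
    by apply: IHl; rewrite e1; apply: Spar.
  (* The path climbs out of [s]. If its last step climbs as well, the reversed path descends
     throughout, so [p n.+1] has rank below that of [s]. *)
  have [[e2 lt2]|[e2 lt2]] := parent_adjP rk (padj n (ltnSn n)).
    have [] := @parent_path_down V par root rank n.+1 _ n rk (parent_rev_path pp) isT _ _.
    - by rewrite subn0 subn1.
    - by [].
    - by rewrite subn0 subnn p0s; have := smin _ Sn; lia.
  case: (pselect (p n.+1 = s)) => [pns|pns].
    by have : 0 = n.+1 by apply: pinj => //; rewrite p0s pns.
  by apply: IHr; rewrite e2; apply: Spar.
have [lt2 e2] := @parent_path_down V par root rank n.+1 p n rk pp isT lt1 (ltnSn n).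
case: (pselect (p n.+1 = s)) => [pns|pns]; last by apply: IHr; rewrite e2; apply: Spar.
by rewrite pns in lt2; have := smin _ S0; lia.
Qed.

(** * Layerings *)

(** The choice is made from the predicate [r v]. Related points have equal predicates by
    extensionality, and proof irrelevance identifies the existence proofs, hence the chosen
    elements. *)
Lemma class_representatives (V : Type) (r : V -> V -> Prop) :
  (forall v, r v v) -> (forall u v, r u v -> r v u) ->
  (forall u v w, r u v -> r v w -> r u w) ->
  exists f : V -> V, (forall v, r v (f v)) /\ (forall u v, r u v -> f u = f v).
Proof.
move=> rr rs rt; have ex v : exists w, r v w by exists v.
exists (fun v => projT1 (cid (ex v))); split => [v|u v ruv].
  exact: projT2 (cid (ex v)).
have e : r u = r v.
  by apply/funext => w; apply/propext; split; apply: rt => //; apply: rs.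
move: (ex u) (ex v); rewrite e => h1 h2.
by rewrite (Prop_irrelevance h1 h2).
Qed.

Lemma least_nat (P : nat -> Prop) :
  (exists n, P n) -> exists n, P n /\ forall k, P k -> n <= k.
Proof.
move=> [n]; elim/ltn_ind: n => n IH Pn.
case: (pselect (exists2 k, k < n & P k)) => [[k kn Pk]|none]; first exact: IH Pk.
by exists n; split => // k Pk; rewrite leqNgt; apply/negP => kn; apply: none; exists k.
Qed.

(* [lev] is the distance to a root chosen in each component. *)
Record layering (G : graph) (lev : G -> nat) (par : G -> G) : Prop := {
  layering_adj : forall u v, adj u v -> lev u <= (lev v).+1;
  layering_par : forall v, 0 < lev v -> adj (par v) v /\ lev v = (lev (par v)).+1;
  layering_root : forall n u v,
    linked setT n u v -> lev u = 0 -> lev v = 0 -> u = v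
}.

Lemma layering_exists (G : graph) : exists lev par, @layering G lev par.
Proof.
have [|||rep [repP repE]] :=
  @class_representatives G (fun u v => exists n, linked setT n u v).
- by move=> v; exists 0; apply: linked_refl.
- by move=> u v [n uv]; exists n; apply: linked_sym.
- by move=> u v w [m uv] [n vw]; exists (m + n); apply: linked_trans vw.
have [lev levP] := choice (fun v => least_nat (repP v)).
have lev_linked v : linked setT (lev v) v (rep v) by case: (levP v).
have lev_le v n : linked setT n v (rep v) -> lev v <= n by case: (levP v) => _; apply.
have lev0 v : lev v = 0 -> v = rep v.
  by move=> v0; have := lev_linked v; rewrite v0 => -[p [<- <-]].
have step (u v : G) : adj u v -> linked setT 1 u v by apply: linked_edge.
have repA (u v : G) : adj u v -> rep u = rep v by move=> uv; apply: repE; exists 1; auto.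
have levA (u v : G) : adj u v -> lev u <= (lev v).+1.
  move=> uv; apply: lev_le; rewrite (repA _ _ uv) -add1n.
  exact: linked_trans (step _ _ uv) (lev_linked v).
have : forall v, exists w, 0 < lev v -> adj w v /\ lev v = (lev w).+1.
  move=> v; case: (posnP (lev v)) => [_|pos]; first by exists v.
  have [p [p0 pn _ padj]] := lev_linked v; exists (p 1) => _.
  have vp : adj v (p 1) by rewrite -p0; apply: padj.
  split; first exact: adj_sym.
  apply/eqP; rewrite eqn_leq levA //= -(prednK pos) ltnS.
  apply: lev_le; rewrite -(repA _ _ vp); exists (fun i => p i.+1); split => //.
    by rewrite prednK.
  by move=> i ilt; apply: padj; lia.
move=> /choice[par parP]; exists lev, par; split => // n u v uv u0 v0.
by rewrite (lev0 u) // (lev0 v) //; apply: repE; exists n.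
Qed.

Lemma layering_linked (G : graph) lev par n (u v : G) :
  layering lev par -> linked setT n u v -> lev u <= lev v + n.
Proof.
move=> lay; elim: n u => [|n IH] u [p [p0 pn _ padj]].
  by rewrite -p0 -pn addn0.
have := layering_adj lay (padj 0 isT); rewrite p0.
have : lev (p 1) <= lev v + n.
  by apply: IH; exists (fun i => p i.+1); split => // i ilt; apply: padj.
by lia.
Qed.

(** Indexed by level instead of number of steps, so that the ancestors of two vertices are compared
    level by level. *)
Definition ancestor (G : graph) (lev : G -> nat) (par : G -> G) (v : G) (l : nat) : G :=
  iter (lev v - l) par v.

Lemma ancestor_id (G : graph) lev par (v : G) : ancestor lev par v (lev v) = v.
Proof. by rewrite /ancestor subnn. Qed.

Lemma ancestor_lev (G : graph) lev par (v : G) l :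
  layering lev par -> l <= lev v -> lev (ancestor lev par v l) = l.
Proof.
move=> lay le; rewrite /ancestor -[in RHS](subKn le).
elim: (lev v - l) (leq_subr l (lev v)) => [|d IH] dl /=; first by rewrite subn0.
have {IH} e := IH (ltnW dl).
have [|_ e'] := layering_par lay (v := iter d par v); first by rewrite e; lia.
by rewrite e in e'; lia.
Qed.

Lemma ancestor_adj (G : graph) lev par (v : G) l :
  layering lev par -> l < lev v ->
  adj (ancestor lev par v l) (ancestor lev par v l.+1).
Proof.
move=> lay lt; have e : lev v - l = (lev v - l.+1).+1 by lia.
rewrite {1}/ancestor e iterS -/(ancestor lev par v l.+1).
by case: (layering_par lay (v := ancestor lev par v l.+1)); rewrite ?ancestor_lev.
Qed.

Lemma ancestor_linked (G : graph) lev par (v : G) l :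
  layering lev par -> l <= lev v ->
  linked setT (lev v - l) (ancestor lev par v l) v.
Proof.
move=> lay le; exists (fun i => ancestor lev par v (l + i)); split => //.
- by rewrite addn0.
- by rewrite subnKC // ancestor_id.
- by move=> i ilt; rewrite addnS; apply: ancestor_adj => //; lia.
Qed.

Lemma ancestors_meet (G : graph) lev par n (u v : G) :
  layering lev par -> linked setT n u v ->
  exists j, [/\ j <= lev u, j <= lev v,
    ancestor lev par u j = ancestor lev par v j &
    forall l, j < l -> l <= lev u -> l <= lev v ->
      ancestor lev par u l <> ancestor lev par v l].
Proof.
move=> lay uv; pose same l := ancestor lev par u l = ancestor lev par v l.
have same0 : same 0.
  apply: (layering_root lay); rewrite ?ancestor_lev //.
  apply: linked_trans (ancestor_linked lay (leq0n _)) _.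
  exact: linked_trans uv (linked_sym (ancestor_linked lay (leq0n _))).
(* The highest common level is obtained from the least depth below [minn (lev u) (lev v)]. *)
have [|j [[ju jv ej] jmax]] :=
  @least_nat (fun k => [/\ minn (lev u) (lev v) - k <= lev u,
    minn (lev u) (lev v) - k <= lev v & same (minn (lev u) (lev v) - k)]).
  by exists (minn (lev u) (lev v)); rewrite subnn.
exists (minn (lev u) (lev v) - j); split => // l jl lu lv e.
have : j <= minn (lev u) (lev v) - l.
  by apply: jmax; rewrite subKn ?leq_min ?lu ?lv.
by lia.
Qed.

(** * A loaded cycle between two vertices of a bag *)

Lemma closed_walk_cycle (G : graph) n (g : nat -> G) :
  3 <= n -> (forall i j, i < j -> j < n -> g i <> g j) ->
  (forall i, i < n -> adj (g i) (g i.+1)) -> g n = g 0 ->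
  is_cycle (fun k : 'I_n => g k).
Proof.
move=> n3 ginj gadj gn; split => // [i j e|k].
  apply: val_inj; case: (ssrnat.ltngtP i j) => // lt.
    by case: (ginj _ _ lt (ltn_ord j)).
  by case: (ginj _ _ lt (ltn_ord i)).
have /= := gadj k (ltn_ord k); case: (ltnP k.+1 n) => kn.
  by rewrite modn_small.
have -> : k.+1 = n by have := ltn_ord k; lia.
by rewrite modnn gn.
Qed.

(* A set of edges of a cycle given by its counting function [f]. *)
Definition steps (n : nat) (f : nat -> nat) : {set 'I_n} :=
  [set k : 'I_n | f k < f k.+1]%SET.

(** Each step raises [f] by 0 or 1, so the number of rises telescopes. *)
Lemma card_steps n (f : nat -> nat) a b :
  (forall k, f k <= f k.+1 <= (f k).+1) -> a <= b -> b <= n ->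
  #|[set k : 'I_n | (a <= k < b) && (f k < f k.+1)]%SET| = f b - f a.
Proof.
move=> fstep; elim: b => [|b IH] ab bn.
  have -> : a = 0 by lia.
  by rewrite subnn; apply: eq_card0 => k; rewrite !inE.
case: (ssrnat.ltngtP a b.+1) ab => // [ab|->] _; last first.
  by rewrite subnn; apply: eq_card0 => k; rewrite !inE; lia.
have fab : f a <= f b.
  have := subnKC (ab : a <= b); move: (b - a) => d <-.
  elim: d => [|d IHd]; first by rewrite addn0.
  by rewrite addnS; have := fstep (a + d); lia.
rewrite (cardsD1 (Ordinal bn)) !inE /= ltnSn andbT -ltnS ab /=.
have := IH ab (ltnW bn); have := fstep b.
rewrite (_ : (_ :\ _)%SET = [set k : 'I_n | (a <= k < b) && (f k < f k.+1)]%SET).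
  by move=> ? ->; lia.
by apply/finset.setP => k; rewrite !inE -val_eqE /=; case: (f k < f k.+1); lia.
Qed.

Lemma load_dist_steps n (f : nat -> nat) (i j : 'I_n) :
  (forall k, f k <= f k.+1 <= (f k).+1) -> f 0 = 0 -> i <= j ->
  load_dist (steps n f) i j = minn (f j - f i) (f n - (f j - f i)).
Proof.
move=> fstep f0 ij.
have e : #|cycle_arc i j :&: steps n f|%SET = f j - f i.
  rewrite -(@card_steps n) //; last exact: ltnW.
  apply: eq_card => k; rewrite !inE.
  by move/minn_idPl: (ij) => ->; move/maxn_idPr: (ij) => ->.
have := card_cycle_arcC (steps n f) i j; rewrite /load_dist e.
have -> : #|steps n f| = f n.
  rewrite -[f n]subn0 -f0 -(@card_steps n) //.
  by apply: eq_card => k; rewrite !inE ltn_ord.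
by lia.
Qed.

(* With [w] the first common ancestor of [u] and [v], the cycle climbs from [w]
   to [u], follows [p], and descends from [v] to [w]; its loaded edges are the
   edges off [p] that lie above level [s], the number of them being [m] or
   [m - 1].  A shortcut between the two loaded segments would give a path from
   [u] to [v] with fewer than [m] edges, and all the other inequalities follow
   from comparing levels. *)
Lemma geodesic_loaded_cycle (R : realType) (G : graph) lev par m n (u v : G) p :
  layering lev par -> 2 <= m -> (forall k, linked setT k u v -> m <= k) ->
  lev u <= (lev v).+1 -> lev v <= (lev u).+1 ->
  is_path n p -> p 0 = u -> p n = v ->
  (forall i, 0 < i < n -> maxn (lev u) (lev v) <= lev (p i)) ->
  exists k (c : 'I_k -> G) (F : {set 'I_k}),
    [/\ is_cycle c, geodesic R c F & m <= #|F|.+1].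
Proof.
move=> lay m2 mmin luv lvu pp p0 pn plev.
have uv : linked setT n u v.
  by rewrite -p0 -pn -[n in linked _ n]subn0; apply: path_linked pp _ _.
have mn := mmin _ uv.
have [j [ju jv ej jmax]] := ancestors_meet lay uv.
have mj : m <= (lev u - j) + (lev v - j).
  apply: mmin; apply: linked_trans (linked_sym (ancestor_linked lay ju)) _.
  by rewrite ej; apply: ancestor_linked.
pose a := lev u - j; pose N := a + n + (lev v - j).
(* Loading what lies above level [s] gives [lev u + lev v - 2 * s] edges, which is [m] or [m - 1]
   according to parity. As [m] is at least 2, [s] exceeds neither [lev u] nor [lev v]. *)
pose s := (lev u + lev v - m).+1 %/ 2.
have s1 : lev u + lev v - m <= s + s by rewrite /s; lia.
have s2 : s + s <= (lev u + lev v - m).+1 by rewrite /s; lia.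
have ea : a = lev u - j by [].
have eN : N = a + n + (lev v - j) by [].
clearbody a N s.
have js : j <= s by lia.
have su : s <= lev u by lia.
have sv : s <= lev v by lia.
pose g x := if x <= a then ancestor lev par u (j + x)
  else if x <= a + n then p (x - a) else ancestor lev par v (j + (N - x)).
have g1 x : x <= a -> g x = ancestor lev par u (j + x) by rewrite /g => ->.
have g2 x : a <= x <= a + n -> g x = p (x - a).
  move=> /andP[ax xn]; rewrite /g xn; case: (leqP x a) => // xa.
  have -> : x = a by lia.
  by rewrite subnn p0 (_ : j + a = lev u) ?ancestor_id //; lia.
have g3 x : a + n <= x -> g x = ancestor lev par v (j + (N - x)).
  move=> anx; rewrite /g; case: (leqP x a) => [|_]; first by lia.
  case: (leqP x (a + n)) => // xan.
  have -> : x - a = n by lia.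
  by rewrite pn (_ : j + _ = lev v) ?ancestor_id //; lia.
have l1 x : x <= a -> lev (g x) = j + x.
  by move=> xa; rewrite g1 // ancestor_lev //; lia.
have l2 x : a < x < a + n -> maxn (lev u) (lev v) <= lev (g x).
  by move=> ?; rewrite g2; [apply: plev|]; lia.
have l3 x : a + n <= x <= N -> lev (g x) = j + (N - x).
  by move=> ?; rewrite g3 ?ancestor_lev //; lia.
clearbody g.
have [pinj padj] := pp.
have cyc : is_cycle (fun k : 'I_N => g k).
  apply: closed_walk_cycle; first by lia.
  - move=> x y xy yN e.
    have := congr1 lev e.
    case: (leqP x a) => xa; [rewrite (l1 x) //|].
      case: (leqP y a) => ya; first by rewrite l1 //; lia.
      case: (leqP (a + n) y) => yan; last first.
        have := l2 y; rewrite ya yan => /(_ isT) yl xl.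
        have xe : x = a by lia.
        move: e; rewrite (g2 x) ?(g2 y); [|lia..] => /pinj; lia.
      rewrite l3 ?yan ?(ltnW yN) // => xl.
      (* Equal levels give [x = N - y], which is positive because [y < N]; so the level [j + x] is
         above [j]. *)
      apply: (jmax (j + x)); [lia|lia|lia|].
      by rewrite -g1 // e g3 // -xl.
    case: (leqP (a + n) y) => yan; last first.
      by move: e; rewrite (g2 x) ?(g2 y); [|lia..] => /pinj; lia.
    rewrite (l3 y) ?yan ?(ltnW yN) //.
    case: (leqP (a + n) x) => xan; first by rewrite (l3 x); lia.
    have := l2 x; rewrite xa xan => /(_ isT) xl yl.
    have ye : y = a + n by lia.
    move: e; rewrite (g2 x) ?(g2 y); [|lia..] => /pinj; lia.
  - move=> x xN; case: (ltnP x a) => xa.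
      by rewrite !g1; [rewrite addnS; apply: ancestor_adj => //; lia|lia..].
    case: (ltnP x (a + n)) => xan.
      rewrite !g2; [|lia..].
      by rewrite subSn //; apply: padj; lia.
    rewrite !g3; [|lia..]; apply: adj_sym.
    have -> : j + (N - x) = (j + (N - x.+1)).+1 by lia.
    by apply: ancestor_adj => //; lia.
  - by rewrite (g1 0) // (g3 N) ?subnn ?addn0 //; lia.
(* [f x] counts the loaded edges among the first [x]: the climb is loaded after its first [s - j]
   edges, the descent on its first [lev v - s]. *)
pose f x := (minn x a - (s - j)) + minn (x - (a + n)) (lev v - s).
have fstep k : f k <= f k.+1 <= (f k).+1 by rewrite /f; clear; lia.
have f0 : f 0 = 0 by rewrite /f; clear -js su sv ea eN; lia.
have f1 x : x <= a -> f x = x - (s - j) by rewrite /f; clear -js su sv ea eN; lia.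
have f2 x : a <= x <= a + n -> f x = lev u - s by rewrite /f; clear -js su sv ea eN; lia.
have f3 x : a + n <= x <= N -> f x = lev u - s + minn (x - (a + n)) (lev v - s).
  by rewrite /f; clear -js su sv ea eN; lia.
have fN : f N = (lev u - s) + (lev v - s) by rewrite /f; clear -js su sv ea eN; lia.
clearbody f.
exists N, (fun k => g k), (steps N f); split => //; last first.
  have := @card_steps N f 0 N fstep isT (leqnn _); rewrite f0 subn0 fN => e.
  have -> : #|steps N f| = (lev u - s) + (lev v - s).
    by rewrite -e; apply: eq_card => k; rewrite !inE ltn_ord.
  by lia.
move=> x y.
wlog xy : x y / x <= y.
  move=> H; case: (leqP x y) => [/H//|/ltnW /H].
  rewrite load_dist_sym => h; apply: le_trans h _.
  apply/ereal_infP => _ [k [q [qp q0 qk ->]]]; apply: dist_le.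
  by apply: linked_sym; rewrite -q0 -qk -[k in linked _ k]subn0; apply: path_linked qp _ _.
apply: le_dist => l ld; rewrite load_dist_steps // fN geq_min; apply/orP.
have h1 := layering_linked lay ld; have h2 := layering_linked lay (linked_sym ld).
have := ltn_ord y; move: (nat_of_ord x) (nat_of_ord y) => {}x {}y in xy ld h1 h2 *.
move=> yN.
case: (leqP x a) => xa.
  rewrite l1 // in h1 h2.
  case: (leqP y a) => ya.
    by left; rewrite l1 // in h1 h2; rewrite !f1 //; clear -js su sv h1 h2; lia.
  case: (leqP (a + n) y) => yan; last first.
    left; have := l2 y; rewrite ya yan => /(_ isT); rewrite (f1 x) // (f2 y); last by lia.
    by clear -js su sv h1 h2 ea ju; lia.
  (* The two vertices are on opposite segments, and the arc through the common ancestor is the one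
     to bound. If both lie above level [s], its load is at most [m] minus the distances climbed to
     [u] and [v]; otherwise it is at most the difference of levels. *)
  have m_le : m <= (a - x) + l + (y - (a + n)).
    have ux : linked setT (a - x) (g x) u.
      have := @ancestor_linked _ _ _ u (j + x) lay; rewrite -g1 //.
      by rewrite (_ : lev u - _ = a - x); [apply|]; lia.
    have vy : linked setT (y - (a + n)) (g y) v.
      have := @ancestor_linked _ _ _ v (j + (N - y)) lay; rewrite -g3 //.
      by rewrite (_ : lev v - _ = y - (a + n)); [apply|]; lia.
    apply: mmin; apply: linked_trans vy; apply: linked_trans ld.
    exact: linked_sym.
  rewrite l3 in h1 h2; last by lia.
  right; rewrite (f1 x) // (f3 y); last by lia.
  by clear -js su sv h1 h2 ea eN ju jv xa yan yN s1 s2 m_le; lia.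
have l3y : a + n <= y -> lev (g y) = j + (N - y) by move=> ?; apply: l3; lia.
left; case: (leqP (a + n) y) => yan; last by rewrite !f2; lia.
rewrite (f3 y); last by lia.
rewrite l3y // in h1 h2.
case: (leqP (a + n) x) => xan.
  rewrite l3 in h1 h2; last by lia.
  by rewrite f3; [clear -js su sv h1 h2 xy yN xan; lia|lia].
have := l2 x; rewrite xa xan => /(_ isT); rewrite (f2 x); last by lia.
by clear -js su sv h1 h2 ea eN ju jv yan yN; lia.
Qed.

(** * The tree-decomposition of a layering *)

(** A class is the lowest level of a component of the subgraph of the vertices of level at least i,
    and stands for that component. *)
Definition same_class (G : graph) (lev : G -> nat) (u v : G) : Prop :=
  lev u = lev v /\ exists n, linked [set x | lev u <= lev x] n u v.

Lemma same_class_refl (G : graph) (lev : G -> nat) u : same_class lev u u.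
Proof. by split => //; exists 0; apply: linked_refl => /=. Qed.

Lemma same_class_sym (G : graph) (lev : G -> nat) u v :
  same_class lev u v -> same_class lev v u.
Proof. by move=> [e [n uv]]; split => //; exists n; rewrite -e; apply: linked_sym. Qed.

Lemma same_class_trans (G : graph) (lev : G -> nat) u v w :
  same_class lev u v -> same_class lev v w -> same_class lev u w.
Proof.
move=> [e [m uv]] [e' [n vw]]; split; first by rewrite e.
by exists (m + n); apply: linked_trans uv _; rewrite e.
Qed.

(** The component of [t] joins all neighbours of its class one level down, so these form part of a
    single class, which supplies the parent node. *)
Lemma same_class_par (G : graph) lev par (t x y : G) :
  layering lev par -> same_class lev t y -> adj x y -> lev t = (lev x).+1 ->
  same_class lev (par t) x.
Proof.
move=> lay [ety [n ty]] xy etx.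
have [|pt ept] := layering_par lay (v := t); first by rewrite etx.
have e : lev (par t) = lev x by lia.
split => //; exists (1 + n + 1); apply: (@linked_trans _ _ _ _ _ y).
  apply: (@linked_trans _ _ _ _ _ t); first by apply: linked_edge => //=; lia.
  by apply: linked_sub ty => z /=; lia.
by apply: linked_edge; [rewrite /=; lia|rewrite /=; lia|apply: adj_sym].
Qed.

(* The nodes are the vertices of [G] and one extra root.  The representative of
   a class hangs below that of the class its parents lie in, and the other
   members of a class are leaves attached to their representative. *)
Definition node_parent (G : graph) (lev : G -> nat) (par canon : G -> G)
    (t : option G) : option G :=
  if t is Some v then
    if `[< canon v = v >] then if lev v == 0 then None else Some (canon (par v))
    else Some (canon v)
  else None.

(** Doubling the level leaves a value for the leaves attached to a representative; the offset 1
    leaves 0 to the extra root. *)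
Definition node_rank (G : graph) (lev : G -> nat) (canon : G -> G)
    (t : option G) : nat :=
  if t is Some v then (lev v).*2.+1 + ~~ `[< canon v = v >] else 0.

(** The extra root joins the trees of the components, and its empty bag adds nothing to the
    diameter. *)
Definition node_bag (G : graph) (lev : G -> nat) (t : option G) : set G :=
  if t is Some v then
    [set x | same_class lev v x \/
      exists y, [/\ same_class lev v y, adj x y & lev v = (lev x).+1]]
  else set0.

Definition class_choice (G : graph) (lev : G -> nat) (canon : G -> G) : Prop :=
  (forall v, same_class lev v (canon v)) /\
  (forall u v, same_class lev u v -> canon u = canon v).

Lemma canonK (G : graph) (lev : G -> nat) canon v :
  class_choice lev canon -> canon (canon v) = canon v.
Proof. by move=> [cP cE]; apply/esym/cE. Qed.

Lemma canon_lev (G : graph) (lev : G -> nat) canon v :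
  class_choice lev canon -> lev (canon v) = lev v.
Proof. by move=> [cP cE]; case: (cP v). Qed.

Lemma node_ranked (G : graph) lev par canon :
  @layering G lev par -> class_choice lev canon ->
  ranked (node_parent lev par canon) None (node_rank lev canon).
Proof.
move=> lay cc; split => // -[v _|//] /=.
case: asboolP => cv /=; last first.
  by rewrite (canonK _ cc) asboolT //= (canon_lev _ cc); lia.
case: posnP => // v0 /=.
have [_ e] := layering_par lay v0.
by rewrite (canonK _ cc) asboolT //= (canon_lev _ cc) e; lia.
Qed.

(** With [node_bag_rank], this allows [parent_path_convex] to be applied to the nodes whose bag
    contains [x], with top node [Some (canon x)]. *)
Lemma node_bag_parent (G : graph) lev par canon (x : G) t :
  layering lev par -> class_choice lev canon ->
  node_bag lev t x -> t <> Some (canon x) -> node_bag lev (node_parent lev par canon t) x.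
Proof.
move=> lay cc; have [cP cE] := cc; case: t => //= t tx tcx.
case: asboolP => ct; last first.
  have ct' := same_class_sym (cP t).
  case: tx => [tx|[y [ty xy e]]]; first by left; apply: same_class_trans ct' tx.
  by right; exists y; split => //; [apply: same_class_trans ct' ty|rewrite (canon_lev _ cc)].
case: tx => [tx|[y [ty xy e]]]; first by case: tcx; rewrite -(cE _ _ tx) ct.
rewrite e /=; left.
by apply: same_class_trans (same_class_sym (cP _)) (same_class_par lay ty xy e).
Qed.

Lemma node_bag_rank (G : graph) lev canon (x : G) t :
  class_choice lev canon -> node_bag lev t x ->
  node_rank lev canon (Some (canon x)) <= node_rank lev canon t.
Proof.
move=> cc; case: t => //= t tx; rewrite (canonK _ cc) asboolT // (canon_lev _ cc).
have : lev x <= lev t by case: tx => [[->]|[y [_ _ ->]]].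
by lia.
Qed.

Lemma layering_tree_decomposition (G : graph) lev par canon :
  @layering G lev par -> class_choice lev canon ->
  @tree_decomposition G (parent_graph (node_parent lev par canon)) (node_bag lev).
Proof.
move=> lay cc; have rk := node_ranked lay cc; split.
- exact: parent_graph_tree rk.
- by move=> v; exists (Some v); left; apply: same_class_refl.
- move=> u v uv.
  wlog luv : u v uv / lev u <= lev v.
    move=> H; case: (leqP (lev u) (lev v)) => [/H|/ltnW /H]; first exact.
    by move=> /(_ (adj_sym uv))[t [? ?]]; exists t.
  exists (Some v); split; last by left; apply: same_class_refl.
  have := layering_adj lay (adj_sym uv); rewrite leq_eqVlt => /orP[/eqP e|lt].
    by right; exists v; split => //; apply: same_class_refl.
  have e : lev v = lev u by lia.
  left; split => //; exists 1.
  by apply: linked_edge; [rewrite /=|rewrite /= e|apply: adj_sym].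
- move=> n p pp i ile x [Bx0 Bxn].
  apply: (parent_path_convex (S := [set t | node_bag lev t x]) rk _ _ pp Bx0 Bxn ile).
    by move=> t /= tx ts; apply: node_bag_parent ts.
  by move=> t /= tx; apply: node_bag_rank tx.
Qed.

(** Only [x] itself may lie below the level of [t]; hence two vertices of a bag are joined by a path
    whose interior is at least as high as both. *)
Lemma node_bag_linked (G : graph) (lev : G -> nat) (t x : G) :
  node_bag lev (Some t) x ->
  exists n, linked [set z | lev t <= lev z \/ z = x] n x t.
Proof.
case=> [[e [n tx]]|[y [[e [n ty]] xy etx]]].
  by exists n; apply: linked_sym; apply: linked_sub tx => z; left.
exists (1 + n); apply: (@linked_trans _ _ _ _ _ y).
  by apply: linked_edge => //=; [right|left; rewrite e].
by apply: linked_sym; apply: linked_sub ty => z; left.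
Qed.

Lemma node_bag_lev (G : graph) (lev : G -> nat) (t x : G) :
  node_bag lev (Some t) x -> lev x <= lev t <= (lev x).+1.
Proof. by case=> [[-> _]|[y [_ _ ->]]]; rewrite leqnn leqnSn. Qed.

Lemma glc_ge0 (R : realType) (G : graph) : (0 <= glc R G)%E.
Proof. by apply: le_ereal_sup_tmp; exists 0%E => //; left. Qed.

Lemma node_bag_dist (R : realType) (G : graph) lev par t (u v : G) :
  layering lev par -> node_bag lev t u -> node_bag lev t v ->
  (dist R u v <= glc R G + 1)%E.
Proof.
move=> lay; case: t => //= t tu tv.
have /andP[lut ltu] := node_bag_lev tu; have /andP[lvt ltv] := node_bag_lev tv.
have [n1 ut] := node_bag_linked tu; have [n2 vt] := node_bag_linked tv.
pose P := [set z | maxn (lev u) (lev v) <= lev z \/ (z = u \/ z = v)].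
have uv : linked P (n1 + n2) u v.
  apply: (@linked_trans _ _ _ _ _ t).
    by apply: linked_sub ut => z [lt|->]; [left; lia|right; left].
  by apply: linked_sym; apply: linked_sub vt => z [lt|->]; [left; lia|right; right].
have [m [muv mmin]] : exists m, linked setT m u v /\ forall k, linked setT k u v -> m <= k.
  by apply: least_nat; exists (n1 + n2); apply: linked_sub uv.
apply: le_trans (dist_le R muv) _.
have glc0 := glc_ge0 R G.
(* A distance of at most 1 is covered by the summand 1 alone. *)
have [m2|m2] := leqP 2 m; last first.
  apply: (@le_trans _ _ (0 + 1)%E); last exact: leeD.
  by rewrite add0e lee_fin (ler_nat R m 1).
have [n [p [_ pp p0 pn pP]]] := linked_path uv.
have [||i /andP[i0 iltn]|k [c [F [cyc geo mF]]]] :=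
  geodesic_loaded_cycle R lay m2 mmin _ _ pp p0 pn; [lia|lia| |].
  have [pinj _] := pp.
  have [//|[e|e]] := pP i (ltnW iltn).
    suff : i = 0 by lia.
    by apply: pinj => //; [exact: ltnW|rewrite e p0].
  suff : i = n by lia.
  by apply: pinj => //; [exact: ltnW|rewrite e pn].
apply: (@le_trans _ _ (#|F|%:R%:E + 1)%E).
  by rewrite -EFinD lee_fin natr1 ler_nat.
by apply: leeD => //; apply: le_ereal_sup_tmp; exists (#|F|%:R%:E) => //; right; exists k, c, F.
Qed.

Lemma odw_le_glc (R : realType) (G : graph) : (odw R G <= glc R G + 1)%E.
Proof.
have [lev [par lay]] := layering_exists G.
have [canon cc] := class_representatives (@same_class_refl G lev)
  (@same_class_sym G lev) (@same_class_trans G lev).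
apply: ge_ereal_inf; exists (outer_diameter R
  (node_bag lev : parent_graph (node_parent lev par canon) -> set G)).
  exists (parent_graph (node_parent lev par canon)), (node_bag lev); split => //.
  exact: layering_tree_decomposition.
have glc0 := glc_ge0 R G.
apply/ereal_supP => _ [t _ <-]; apply/ereal_supP => _ [->|[u [v [tu tv ->]]]].
  exact: adde_ge0.
exact: node_bag_dist lay tu tv.
Qed.

Local Open Scope ereal_scope.

Theorem theorem1p5 (R : realType) (G : graph) :
  odw R G - 1 <= glc R G /\ glc R G <= 3%:R%:E * odw R G.
Proof.
by split; [rewrite leeBlDr //; apply: odw_le_glc|apply: glc_le_odw].
Qed.
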